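(* For every positive integer $n$, stit logic has the Restricted $n$-Robinson Consistency Property $(RRCP)_n$ if and only if it has the Restricted $n$-Craig Interpolation Property $(RCIP)_n$. Here $(RRCP)_n$ means: for every set of propositional variables $V$ and all $\Gamma, \Delta \subseteq \mathcal{L}^{\{1,\ldots,n\}}_V$, if the pair $(\Gamma,\Delta)$ is inseparable then $\Gamma \cup \Delta$ is consistent; and $(RCIP)_n$ means: for every set of propositional variables $V$ and all $A,B \in \mathcal{L}^{\{1,\ldots,n\}}_V$ with $\vdash A \to B$ and $Ag(A)\cap Ag(B) = \emptyset$, there exists $C \in \mathcal{L}^{Ag(A)\cup Ag(B)}_{|A|\cap|B|}$ with $\vdash A \to C$ and $\vdash C \to B$.
   Context: For a finite set $Ag$ of agent indices and a set $V$ of propositional variables, $\mathcal{L}^{Ag}_V$ is the set of stit formulas given by $A ::= p \mid A \to A \mid \bot \mid \Box A \mid [j]A$ with $p \in V$, $j \in Ag$ (other Boolean connectives defined as usual; $\Diamond A := \neg\Box\neg A$). $\vdash A$ means derivability in the axiom system $\mathbb{S}$ with axioms: all classical propositional tautologies; S5 axioms for $\Box$ and for each $[j]$; $\Box A \to [j]A$; and $(\Diamond[j_1]A_1 \wedge\dots\wedge \Diamond[j_k]A_k) \to \Diamond([j_1]A_1\wedge\dots\wedge[j_k]A_k)$ for pairwise distinct $j_1,\dots,j_k$; rules: modus ponens and necessitation for $\Box$. For a set $\Gamma$ of formulas, $\Gamma \vdash A$ means $\vdash (A_1\wedge\dots\wedge A_r)\to A$ for some $A_1,\dots,A_r \in \Gamma$;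 $\Gamma$ is consistent iff not $\Gamma\vdash\bot$. $|\Gamma|$ denotes the set of propositional variables occurring in formulas of $\Gamma$ and $Ag(\Gamma)$ the set of agent indices occurring in $\Gamma$ (for a single formula $A$, $|A| = |\{A\}|$, $Ag(A) = Ag(\{A\})$). A pair $(\Gamma,\Delta)$ of sets of formulas is inseparable iff $Ag(\Gamma)\cap Ag(\Delta) = \emptyset$ and there is no $C \in \mathcal{L}^{Ag(\Gamma)\cup Ag(\Delta)}_{|\Gamma|\cap|\Delta|}$ such that both $\Gamma \vdash C$ and $\Delta \vdash \neg C$. *)

(* Defs.v *)
From Stdlib Require List.
From mathcomp Require Import all_boot.
From mathcomp Require Import classical_sets.

Set Implicit Arguments.
Unset Strict Implicit.
Unset Printing Implicit Defensive.

Local Open Scope classical_set_scope.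

Inductive form (V Ag : Type) : Type :=
  | Var of V
  | Imp of form V Ag & form V Ag
  | Bot
  | Box of form V Ag
  | Stit of Ag & form V Ag.

Arguments Var {V Ag} p.
Arguments Bot {V Ag}.

Section Syntax.
Variables V Ag : Type.
Implicit Types (A B : form V Ag) (G : set (form V Ag)).

Definition Neg A : form V Ag := Imp A Bot.
Definition Top : form V Ag := Neg Bot.
Definition And A B : form V Ag := Neg (Imp A (Neg B)).
Definition Dia A : form V Ag := Neg (Box (Neg A)).

Fixpoint bigAnd (s : seq (form V Ag)) : form V Ag :=
  match s with
  | [::] => Top
  | [:: A] => A
  | A :: s' => And A (bigAnd s')
  end.

Fixpoint vars A : set V :=
  match A with
  | Var p => [set p]
  | Imp B C => vars B `|` vars C
  | Bot => set0
  | Box B => vars B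
  | Stit _ B => vars B
  end.

Fixpoint agents A : set Ag :=
  match A with
  | Var _ => set0
  | Imp B C => agents B `|` agents C
  | Bot => set0
  | Box B => agents B
  | Stit j B => [set j] `|` agents B
  end.

Definition vars_of G : set V := \bigcup_(A in G) vars A.
Definition agents_of G : set Ag := \bigcup_(A in G) agents A.

(* The sublanguage with variables in W and agent indices in J; the full
   language L^Ag_V is the type [form V Ag] itself. *)
Fixpoint lang (W : set V) (J : set Ag) A : Prop :=
  match A with
  | Var p => W p
  | Imp B C => lang W J B /\ lang W J C
  | Bot => True
  | Box B => lang W J B
  | Stit j B => J j /\ lang W J B
  end.

(* Variables and modal formulas are treated as atoms: v is only consulted on
   formulas whose main constructor is Var, Box or Stit. *)
Fixpoint peval (v : form V Ag -> bool) A : bool :=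
  match A with
  | Imp B C => peval v B ==> peval v C
  | Bot => false
  | _ => v A
  end.

Definition tautology A : Prop := forall v, peval v A.

Inductive S5_axiom (box : form V Ag -> form V Ag) : form V Ag -> Prop :=
  | S5_K A B : S5_axiom box (Imp (box (Imp A B)) (Imp (box A) (box B)))
  | S5_T A : S5_axiom box (Imp (box A) A)
  | S5_4 A : S5_axiom box (Imp (box A) (box (box A)))
  | S5_5 A : S5_axiom box (Imp (Neg (box A)) (box (Neg (box A)))).

End Syntax.

Arguments Top {V Ag}.

Section Derivability.
Variables (V : Type) (Ag : finType).
Implicit Types (A B C : form V Ag) (G D : set (form V Ag)).

(* In prov_indep, s lists the pairs (j_1, A_1), ..., (j_k, A_k). *)
Inductive prov : form V Ag -> Prop :=
  | prov_taut A : tautology A -> prov A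
  | prov_S5_Box A : S5_axiom (@Box V Ag) A -> prov A
  | prov_S5_Stit j A : S5_axiom (Stit j) A -> prov A
  | prov_Box_Stit j A : prov (Imp (Box A) (Stit j A))
  | prov_indep (s : seq (Ag * form V Ag)) :
      0 < size s -> uniq [seq x.1 | x <- s] ->
      prov (Imp (bigAnd [seq Dia (Stit x.1 x.2) | x <- s])
                (Dia (bigAnd [seq Stit x.1 x.2 | x <- s])))
  | prov_mp A B : prov (Imp A B) -> prov A -> prov B
  | prov_nec A : prov A -> prov (Box A).

(* The empty conjunction (= Top) is allowed, so theorems follow from the empty
   set of premises. *)
Definition entails G A : Prop :=
  exists s : seq (form V Ag), List.Forall G s /\ prov (Imp (bigAnd s) A).

Definition consistent G : Prop := ~ entails G Bot.

Definition inseparable G D : Prop :=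
  agents_of G `&` agents_of D = set0 /\
  ~ exists C, [/\ lang (vars_of G `&` vars_of D)
                       (agents_of G `|` agents_of D) C,
                  entails G C & entails D (Neg C)].

End Derivability.

(* The agent set {1, ..., n} is represented by 'I_n. *)
Definition RRCP (n : nat) : Prop :=
  forall (V : Type) (G D : set (form V 'I_n)),
    inseparable G D -> consistent (G `|` D).

Definition RCIP (n : nat) : Prop :=
  forall (V : Type) (A B : form V 'I_n),
    prov (Imp A B) -> agents A `&` agents B = set0 ->
    exists C, [/\ lang (vars A `&` vars B) (agents A `|` agents B) C,
                  prov (Imp A C) & prov (Imp C B)].

(* Main.v *)
Require Import Defs.
From mathcomp Require Import all_boot.
From mathcomp Require Import boolp classical_sets.

(** Consistency of a pair [(Gamma, Delta)] only concerns finitely many premises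
    at a time.  Interpolation follows from Robinson consistency applied to
    [{A}] and [{~ B}]; conversely, an inconsistency of the union yields finite
    conjunctions [A] of members of [Gamma] and [B] of members of [Delta] with
    [|- A -> ~ B], and an interpolant for this implication separates the pair. *)

Set Implicit Arguments.
Unset Strict Implicit.
Unset Printing Implicit Defensive.

Local Open Scope classical_set_scope.

Section Language.
Variables V Ag : Type.
Implicit Types (A B C : form V Ag) (G D : set (form V Ag)).
Implicit Types (s : seq (form V Ag)).

Lemma peval_bigAnd v s : peval v (bigAnd s) = all (peval v) s.
Proof.
elim: s => [|A [|B s] IHs] //; first by rewrite /= andbT.
(* [bigAnd] of a singleton is not [And A Top], so the recursive unfolding starts at two elements. *)
transitivity (peval v A && peval v (bigAnd (B :: s))); last by rewrite IHs.
by rewrite /=; do 2?case: (peval v _).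
Qed.

Lemma vars_bigAnd G s : List.Forall G s -> vars (bigAnd s) `<=` vars_of G.
Proof.
elim=> [|A {}s GA Gs IHs]; first by move=> p /= [].
have varsA : vars A `<=` vars_of G by move=> p Ap; exists A.
case: s Gs IHs => [|B s] _ IHs //= p.
by case=> [[/varsA //|[/IHs //|[]]]|[]].
Qed.

Lemma agents_bigAnd G s : List.Forall G s -> agents (bigAnd s) `<=` agents_of G.
Proof.
elim=> [|A {}s GA Gs IHs]; first by move=> j /= [].
have agentsA : agents A `<=` agents_of G by move=> j Aj; exists A.
case: s Gs IHs => [|B s] _ IHs //= j.
by case=> [[/agentsA //|[/IHs //|[]]]|[]].
Qed.

Lemma lang_mono (W W' : set V) (J J' : set Ag) C :
  W `<=` W' -> J `<=` J' -> lang W J C -> lang W' J' C.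
Proof.
move=> WW' JJ'; elim: C => //= [A IHA B IHB [/IHA ? /IHB ?] //|].
by move=> j A IHA [/JJ' ? /IHA ?].
Qed.

(** The list is an interleaving of the two parts. Recording this through [all] avoids permutations:
    only the truth value of a conjunction matters later. *)
Lemma Forall_setU_split G D s : List.Forall (G `|` D) s ->
  exists s1 s2, [/\ List.Forall G s1, List.Forall D s2 &
    forall p, all p s = all p s1 && all p s2].
Proof.
elim=> [|A {}s GDA _ [s1 [s2 [Gs1 Ds2 alls]]]]; first by exists [::], [::].
case: GDA => [GA|DA].
  by exists (A :: s1), s2; split=> [||p]; [constructor| |rewrite /= alls andbA].
exists s1, (A :: s2); split=> [||p]; [by []|by constructor|].
by rewrite /= alls andbCA.
Qed.

End Language.

Section Derivability.
Variables (V : Type) (Ag : finType).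
Implicit Types (A B C : form V Ag) (G D : set (form V Ag)).

(** Reduces each propositional step to a truth-value check with modal formulas as atoms. *)
Lemma prov_taut_imp A B :
  (forall v, peval v A -> peval v B) -> prov A -> prov B.
Proof.
by move=> AB; apply: prov_mp; apply: prov_taut => v; apply/implyP/AB.
Qed.

(** Premises drawn from a singleton are copies of [A], possibly none, so [A] propositionally implies
    their conjunction. *)
Lemma entails1P A C : entails [set A] C <-> prov (Imp A C).
Proof.
split=> [[s [sA]]|pAC]; last by exists [:: A]; split=> //; constructor.
apply: prov_taut_imp => v /=; rewrite peval_bigAnd => /implyP sC.
apply/implyP => vA; apply: sC.
by elim: sA => //= B s' -> _ ->; rewrite vA.
Qed.

Lemma inconsistent_setU G D : ~ consistent (G `|` D) ->
  exists s1 s2, [/\ List.Forall G s1, List.Forall D s2 &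
    prov (Imp (bigAnd s1) (Neg (bigAnd s2)))].
Proof.
move/contrapT => [s [/Forall_setU_split[s1 [s2 [Gs1 Ds2 alls]]] pr]].
exists s1, s2; split=> //; apply: prov_taut_imp pr => v /=.
by rewrite !peval_bigAnd alls; do 2!case: (all _ _).
Qed.

Lemma prov_Imp_inconsistent A B :
  prov (Imp A B) -> ~ consistent ([set A] `|` [set Neg B]).
Proof.
move=> pAB; apply; exists [:: A; Neg B]; split.
  by constructor; [left|constructor; [right|constructor]].
apply: prov_taut_imp pAB => v /=.
by do 2!case: (peval v _).
Qed.

End Derivability.

Lemma RRCP_RCIP n : RRCP n -> RCIP n.
Proof.
move=> rob V A B pAB agAB.
have eqv : vars (Neg B) = vars B by rewrite /= setU0.
have eqa : agents (Neg B) = agents B by rewrite /= setU0.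
have : ~ inseparable [set A] [set Neg B].
  by move/rob; exact: prov_Imp_inconsistent.
rewrite /inseparable /vars_of /agents_of !bigcup_set1 eqv eqa => nsep.
(* The agent sets are disjoint, so inseparability can only fail through a separating formula [C]. *)
have [C [langC /entails1P pAC /entails1P pBC]] := contrapT
  (fun nC => nsep (conj agAB nC)).
(* Contraposition turns [Neg B] implies [Neg C] into [C] implies [B]. *)
exists C; split=> //; apply: prov_taut_imp pBC => v /=.
by do 2!case: (peval v _).
Qed.

Lemma RCIP_RRCP n : RCIP n -> RRCP n.
Proof.
move=> itp V G D [agGD nsep]; apply: contrapT.
move=> /inconsistent_setU[s1 [s2 [Gs1 Ds2 pr]]].
have eqv : vars (Neg (bigAnd s2)) = vars (bigAnd s2) by rewrite /= setU0.
have eqa : agents (Neg (bigAnd s2)) = agents (bigAnd s2) by rewrite /= setU0.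
have [vG aG] := (vars_bigAnd Gs1, agents_bigAnd Gs1).
have [vD aD] := (vars_bigAnd Ds2, agents_bigAnd Ds2).
have ag0 : agents (bigAnd s1) `&` agents (Neg (bigAnd s2)) = set0.
  by rewrite eqa; apply: subsetI_eq0 agGD.
have [C [langC pC1 pC2]] := itp _ _ _ pr ag0.
apply: nsep; exists C; split; last 2 first.
- by exists s1.
- exists s2; split=> //; apply: prov_taut_imp pC2 => v /=.
  by do 2!case: (peval v _).
(* The interpolant lives in the language of the finite conjunctions, which is contained in that of
   the pair. *)
by move: langC; rewrite eqv eqa; apply: lang_mono; [apply: setISS|apply: setUSS].
Qed.

Theorem theorem3 (n : nat) (n_gt0 : 0 < n) : RRCP n <-> RCIP n.
Proof. by split; [exact: RRCP_RCIP|exact: RCIP_RRCP]. Qed.
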